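(* Let $(P,\preceq)$ be a connected naturally labeled poset on the ground set $\{1,\dots,n\}$. Let $\tau \in \mathfrak{S}_n$ and $\mathbf{q} = (q_1,\dots,q_n) \in \mathbb{Z}^n$. Then $\mathbf{q} + \Delta_\tau \subseteq \mathcal{L}(P)$ if and only if $\tau$ is descent-compatible with $P$ and $q_a = \mathrm{des}_{P,\tau}(a)$ for all $a \in P$.
   Context: All posets are finite. For a poset $(P,\preceq)$, $a \lessdot b$ denotes a cover relation, and $\check{P} = P \cup \{\hat 0\}$ is $P$ with a new minimum $\hat 0$ adjoined (even if $P$ already has a minimum). A poset is connected if its Hasse diagram is connected. Lipschitz polytope: $\mathcal{L}(P) \subset \mathbb{R}^P$ is the set of all $f : P \to \mathbb{R}$ with $0 \le f(a) \le 1$ for every minimal element $a$ of $P$ and $0 \le f(b)-f(a) \le 1$ for every cover relation $a \lessdot b$ in $P$. $P$ is naturally labeled if its ground set is $\{1,\dots,n\}$, $n = |P|$, and $a \prec b$ implies $a < b$ as integers; then $\mathbb{R}^P = \mathbb{R}^n$ and one sets $\hat 0 := 0$. For $\tau \in \mathfrak{S}_n$ write $\hat\tau = \tau^{-1}$ and set $\tau(0) := 0$. Define $$\Delta_\tau = \{\mathbf{x} \in \mathbb{R}^n : 0 \le x_{\hat\tau(1)} \le x_{\hat\tau(2)} \le \cdots \le x_{\hat\tau(n)} \le 1\}.$$ For a saturated chain $C = \{\hat 0 = c_1 \lessdot c_2 \lessdot \cdots \lessdot c_k = a\}$ in $\check{P}$ let $\mathrm{des}(\tau|_C)$ be the number of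 $1 \le j < k$ with $\tau(c_j) > \tau(c_{j+1})$. The permutation $\tau$ is descent-compatible with $P$ if for every $a \in P$ the number $\mathrm{des}(\tau|_C)$ is the same for all saturated chains $C$ in $\check{P}$ from $\hat 0$ to $a$. In that case $\mathrm{des}_{P,\tau}(a)$ denotes this common number. *)

(* Defs.v *)
From mathcomp Require Import all_boot all_order all_fingroup all_algebra.
From mathcomp Require Import classical_sets reals.

Set Implicit Arguments.
Unset Strict Implicit.
Unset Printing Implicit Defensive.

Import Order.TTheory GRing.Theory Num.Theory.

Definition poset (T : finType) (le : rel T) :=
  [/\ reflexive le, antisymmetric le & transitive le].

Definition strict (T : finType) (le : rel T) : rel T :=
  [rel a b | (a != b) && le a b].

Definition covers (T : finType) (le : rel T) : rel T :=
  [rel a b | strict le a b && [forall c, ~~ (strict le a c && strict le c b)]].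

Definition minimal_elt (T : finType) (le : rel T) (a : T) : bool :=
  [forall b, ~~ strict le b a].

Definition connected_poset (T : finType) (le : rel T) : Prop :=
  forall a b : T, connect [rel x y | covers le x y || covers le y x] a b.

(* The order of the poset with a new minimum adjoined: [None] is the new
   minimum, and [Some a] is the element [a] of the original poset. *)
Definition le_hat (T : finType) (le : rel T) : rel (option T) :=
  fun u v => match u, v with
             | None, _ => true
             | Some _, None => false
             | Some a, Some b => le a b
             end.

(* The saturated chain has elements [None :: s]; [s] omits its bottom. *)
Definition saturated_chain_to (T : finType) (le : rel T) (a : T)
    (s : seq (option T)) : Prop :=
  path (covers (le_hat le)) None s /\ last None s = Some a.

Definition lipschitz_polytope (T : finType) (le : rel T) (R : realType) :
    set {ffun T -> R} :=
  [set f | (forall a, minimal_elt le a -> (0 <= f a <= 1)%R) /\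
           (forall a b, covers le a b -> (0 <= f b - f a <= 1)%R)].

Arguments lipschitz_polytope [T] le R.

(* The ground set {1, ..., n} is represented by ['I_n], the ordinal [i]
   standing for the label [i + 1]; comparing labels is comparing ordinals. *)
Definition naturally_labeled n (le : rel 'I_n) : Prop :=
  poset le /\ forall a b : 'I_n, strict le a b -> (a < b)%N.

(* [tau] extended by [tau 0 = 0], with values in {0, ..., n}; the shift is
   that between ordinals and labels. *)
Definition perm_hat n (tau : 'S_n) (u : option 'I_n) : nat :=
  if u is Some a then (tau a).+1 else 0%N.

(* The number of descents of a word; indices start at 0. *)
Definition descents (w : seq nat) : nat :=
  #|[pred j : 'I_(size w).-1 | (nth 0 w j > nth 0 w j.+1)%N]|.

Definition chain_des n (tau : 'S_n) (s : seq (option 'I_n)) : nat :=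
  descents [seq perm_hat tau u | u <- None :: s].

Definition descent_compatible n (le : rel 'I_n) (tau : 'S_n) : Prop :=
  forall a s1 s2, saturated_chain_to le a s1 -> saturated_chain_to le a s2 ->
    chain_des tau s1 = chain_des tau s2.

(* The value of [chain_des tau] at a saturated chain up to [a]. This is the
   common value when [tau] is descent-compatible (see [des_atE]). *)
Definition des_at n (le : rel 'I_n) (tau : 'S_n) (a : 'I_n) : nat :=
  xget 0%N [set m | exists2 s, saturated_chain_to le a s & m = chain_des tau s].

Lemma des_atE n (le : rel 'I_n) (tau : 'S_n) a s :
  descent_compatible le tau -> saturated_chain_to le a s ->
  chain_des tau s = des_at le tau a.
Proof.
move=> tauP sa; rewrite /des_at.
case: xgetP => [m _ [s' s'a ->]|/(_ (chain_des tau s)) noP].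
  exact: tauP sa s'a.
by case: noP; exists s.
Qed.

(* [tau^-1 i] runs through the coordinates in the order given by the inverse
   permutation, so the path condition is the displayed chain
   0 <= x_{tau^-1(1)} <= ... <= x_{tau^-1(n)} <= 1. *)
Definition simplex (R : realType) n (tau : 'S_n) : set {ffun 'I_n -> R} :=
  [set x | path <=%R 0%R (rcons [seq x ((tau^-1)%g i) | i <- enum 'I_n] 1%R)].

Arguments simplex R [n] tau.

Definition translate (R : realType) n (q : {ffun 'I_n -> int})
    (A : set {ffun 'I_n -> R}) : set {ffun 'I_n -> R} :=
  [set ([ffun a => (q a)%:~R] + x)%R | x in A]%classic.

(* Main.v *)
Require Import Defs.
From mathcomp Require Import all_boot all_order all_fingroup all_algebra.
From mathcomp Require Import classical_sets reals.
From mathcomp Require Import zify lra.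

(** Both sides are equivalent to the same local condition on the extension of
    [q] by [0] at the new minimum: along every cover relation [u < v] of the
    extended poset, [q] increases by [1] if [u, v] is a descent of [tau], and by
    [0] otherwise.  On a translated simplex, the inequalities of the Lipschitz
    polytope are tested at the vertices, the indicators of
    [{c | k <= tau c}]; on chains, the condition telescopes to
    [q a = des (tau|_C)]. *)

Set Implicit Arguments.
Unset Strict Implicit.
Unset Printing Implicit Defensive.

Import Order.TTheory GRing.Theory Num.Theory.

(** Written as a sum over positions, the count splits off its last term, which compares [y] with the
    last letter; the word is kept nonempty so that this letter exists. *)
Lemma descents_rcons x w y :
  descents (rcons (x :: w) y) = descents (x :: w) + (y < last x w).
Proof.
have descentsE v : descents v = \sum_(j < (size v).-1) (nth 0 v j.+1 < nth 0 v j).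
  by rewrite /descents -sum1_card big_mkcond.
rewrite !descentsE size_rcons /= big_ord_recr /=; congr (_ + _); last first.
  rewrite -[nth 0 (rcons w y) _]/(nth 0 (rcons w y) (size w)).
  rewrite nth_rcons ltnn eqxx -rcons_cons nth_rcons /= ltnS leqnn.
  by rewrite -[size w]/((size (x :: w)).-1) nth_last.
apply: eq_bigr => j _.
by rewrite -rcons_cons !nth_rcons /= ltn_ord ltnS (ltnW (ltn_ord j)).
Qed.

Lemma covers_hat_NS (T : finType) (le : rel T) a :
  covers (le_hat le) None (Some a) = minimal_elt le a.
Proof.
rewrite /covers /strict /minimal_elt /=.
apply/forallP/forallP => [h b | h [b|]] //; first exact: (h (Some b)).
exact: h b.
Qed.

Lemma covers_hat_SS (T : finType) (le : rel T) a b :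
  covers (le_hat le) (Some a) (Some b) = covers le a b.
Proof.
rewrite /covers /strict /=; congr (_ && _).
apply/forallP/forallP => [h c | h [c|]] //; first exact: (h (Some c)).
  exact: h c.
Qed.

Lemma covers_hat_N (T : finType) (le : rel T) u :
  covers (le_hat le) u None = false.
Proof. by case: u => [a|]; rewrite /covers /strict /= ?andbF. Qed.

(** Strong induction on the label. Below a non-minimal [a], the element with the largest label is
    covered by [a], since anything strictly between would have a larger label. *)
Lemma saturated_chain_to_exists n (le : rel 'I_n) :
  naturally_labeled le -> forall a, exists s, saturated_chain_to le a s.
Proof.
move=> [[_ _ le_trans] lab] a.
have [m] := ubnP (val a); elim: m a => // m IHm a; rewrite ltnS => a_le_m.
have [min_a|/forallPn[c]] := boolP (minimal_elt le a).
  by exists [:: Some a]; split=> //=; rewrite covers_hat_NS min_a.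
rewrite negbK => c_lt_a.
have [b /= b_lt_a b_max] :=
  @arg_maxnP _ c (strict le ^~ a) (fun b : 'I_n => val b) c_lt_a.
have b_cov : covers le b a.
  apply/andP; split=> //; apply/forallP => d; apply/negP.
  move=> /andP[b_lt_d d_lt_a].
  by have := leq_trans (lab _ _ b_lt_d) (b_max d d_lt_a); rewrite ltnn.
have [s [s_path s_last]] := IHm b (leq_trans (lab _ _ b_lt_a) a_le_m).
exists (rcons s (Some a)); split; last by rewrite last_rcons.
by rewrite rcons_path s_path s_last covers_hat_SS.
Qed.

Lemma simplexP (R : realType) n (tau : 'S_n) (x : {ffun 'I_n -> R}) :
  simplex R tau x <->
  (forall a, (0 <= x a <= 1)%R) /\
  (forall a b, (tau a <= tau b)%N -> (x a <= x b)%R).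
Proof.
rewrite /simplex /= (path_sortedE le_trans) all_rcons ler01 /=.
(* The detour through [pairwise] detaches the final [1] from the sorted list. *)
rewrite (sorted_pairwise le_trans) pairwise_rcons -(sorted_pairwise le_trans).
rewrite sorted_map; split.
- move=> /and3P[/allP ge0 /allP le1 sorted_x]; split=> [a|a b le_ab].
    have xa : x a \in [seq x ((tau^-1)%g i) | i <- enum 'I_n].
      by apply/mapP; exists (tau a); rewrite ?mem_enum ?permK.
    by rewrite ge0 ?le1.
  have := @sorted_leq_nth _ (relpre (fun i => x ((tau^-1)%g i)) <=%R) _ _ a _
    sorted_x (tau a) (tau b).
  rewrite !inE size_enum_ord !ltn_ord !nth_ord_enum /= !permK; apply=> //.
    by move=> i j k /=; apply: le_trans.
  by move=> i /=.
- move=> [x01 x_mono]; apply/and3P; split.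
  + by apply/allP => _ /mapP[i _ ->]; case/andP: (x01 ((tau^-1)%g i)).
  + by apply/allP => _ /mapP[i _ ->]; case/andP: (x01 ((tau^-1)%g i)).
  have : sorted (relpre val ltn) (enum 'I_n).
    by rewrite -sorted_map val_enum_ord iota_ltn_sorted.
  by apply: sub_sorted => i j /= /ltnW lt_ij; apply: x_mono; rewrite !permKV.
Qed.

(** Values of [tau] start at 0 here: [k = 0] gives the all-ones vertex, and [k >= n] the origin. *)
Definition upper_vertex (R : realType) n (tau : 'S_n) (k : nat) :
  {ffun 'I_n -> R} := [ffun c => (k <= tau c)%:R%R].

Lemma simplex_upper_vertex (R : realType) n (tau : 'S_n) k :
  simplex R tau (upper_vertex R tau k).
Proof.
apply/simplexP; split=> [a|a b le_ab]; rewrite !ffunE.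
  by case: (_ <= _)%N; rewrite ?lexx ler01.
by rewrite ler_nat; case: (leqP k (tau a)) => // /leq_trans->.
Qed.

Definition hat_ext n (q : {ffun 'I_n -> int}) (u : option 'I_n) : int :=
  if u is Some a then q a else 0%R.

Definition descent_increments n (le : rel 'I_n) (tau : 'S_n)
    (q : {ffun 'I_n -> int}) : Prop :=
  forall u v, covers (le_hat le) u v ->
    hat_ext q v = (hat_ext q u + (perm_hat tau v < perm_hat tau u)%N%:Z)%R.

Lemma translate_simplex_subP (R : realType) n (le : rel 'I_n) (tau : 'S_n)
    (q : {ffun 'I_n -> int}) :
  (translate q (simplex R tau) `<=` lipschitz_polytope le R)%classic <->
  descent_increments le tau q.
Proof.
split=> [sub|incr].
- have vertex k := sub _ (ex_intro2 _ _ _ (simplex_upper_vertex R tau k) erefl).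
  move=> [a|] [b|]; rewrite ?covers_hat_N // ?covers_hat_SS ?covers_hat_NS /=.
  + move=> ab.
    (* The vertices have integer coordinates, so the inequalities descend from [R] to the
       integers. *)
    have diff k : (0 <= q b - q a + (k <= tau b)%N%:Z - (k <= tau a)%N%:Z <= 1)%R.
      have := (vertex k).2 _ _ ab; rewrite !ffunE.
      rewrite -!(ler_int R) !(intrD, rmorphN) /= -!pmulrn.
      by move=> ?; lra.
    (* At [k = 0] both indicators are 1, hence [0 <= q b - q a <= 1]. *)
    have := diff 0%N; rewrite /= ltnS.
    case: (ltnP (tau b) (tau a)) => [lt_ba|le_ab].
      (* Only the indicator at [a] is 1, which forces [q b - q a >= 1]. *)
      have := diff (tau a); rewrite leqnn leqNgt lt_ba /=; lia.
    have lt_ab : (tau a < tau b)%N.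
      rewrite ltn_neqAle le_ab andbT; apply: contraTneq ab => /val_inj/perm_inj->.
      by rewrite /covers /strict /= eqxx.
    (* Only the indicator at [b] is 1, which forces [q b - q a <= 0]. *)
    have := diff (tau b); rewrite leqnn leqNgt lt_ab /=; lia.
  + move=> min_b.
    have bound k : (0 <= q b + (k <= tau b)%N%:Z <= 1)%R.
      have := (vertex k).1 _ min_b; rewrite !ffunE.
      by rewrite -!(ler_int R) !intrD /= -!pmulrn.
    (* The indicator at [b] is 0 for the first threshold and 1 for the second, so [q b >= 0] and
       [q b <= 0]. *)
    have := bound (tau b).+1; have := bound 0%N; rewrite ltnn /=; lia.
- move=> _ [x /simplexP[x01 x_mono] <-]; split=> [a min_a|a b ab].
    have /= := incr None (Some a); rewrite covers_hat_NS => /(_ min_a) qa.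
    by rewrite !ffunE qa addr0 add0r.
  have /= := incr (Some a) (Some b); rewrite covers_hat_SS => /(_ ab) qb.
  rewrite !ffunE qb rmorphD /= ltnS.
  have /andP[a0 a1] := x01 a; have /andP[b0 b1] := x01 b.
  (* At a descent [x b <= x a], and the increment 1 brings [x b - x a] back into the unit
     interval. *)
  case: (ltnP (tau b) (tau a)) => [/ltnW|] /x_mono; rewrite /=; lra.
Qed.

Lemma chain_des_rcons n (tau : 'S_n) s u :
  chain_des tau (rcons s u) =
  chain_des tau s + (perm_hat tau u < perm_hat tau (last None s))%N.
Proof.
rewrite /chain_des /= map_rcons -rcons_cons descents_rcons.
by rewrite -(last_map (perm_hat tau)).
Qed.

Lemma hat_ext_last n (le : rel 'I_n) (tau : 'S_n) (q : {ffun 'I_n -> int}) s :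
  descent_increments le tau q -> path (covers (le_hat le)) None s ->
  hat_ext q (last None s) = ((chain_des tau s)%:Z)%R.
Proof.
move=> incr; elim/last_ind: s => [_|s u IHs].
  by rewrite /chain_des /descents eq_card0 // => -[].
rewrite rcons_path last_rcons chain_des_rcons PoszD => /andP[/IHs <-].
exact: incr.
Qed.

Lemma descent_incrementsP n (le : rel 'I_n) (tau : 'S_n)
    (q : {ffun 'I_n -> int}) :
  naturally_labeled le ->
  descent_increments le tau q <->
  descent_compatible le tau /\ (forall a, q a = ((des_at le tau a)%:Z)%R).
Proof.
move=> lab; split=> [incr|[compat q_des]].
- have q_chain a s : saturated_chain_to le a s -> q a = ((chain_des tau s)%:Z)%R.
    by move=> [s_path s_last]; rewrite -(hat_ext_last incr s_path) s_last.
  have compat : descent_compatible le tau.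
    by move=> a s1 s2 /q_chain e1 /q_chain e2; apply/eqP; rewrite -eqz_nat -e1 e2.
  split=> // a; have [s sa] := saturated_chain_to_exists lab a.
  by rewrite -(des_atE compat sa) (q_chain _ _ sa).
- have q_last s : path (covers (le_hat le)) None s ->
      hat_ext q (last None s) = ((chain_des tau s)%:Z)%R.
    case s_last : (last None s) => [a|] s_path /=.
      by rewrite q_des -(des_atE compat (conj s_path s_last)).
    (* Only the empty chain ends at the bottom, as [None] covers nothing. *)
    case/lastP: s s_last s_path => [|s u]; last first.
      by rewrite last_rcons rcons_path => ->; rewrite covers_hat_N andbF.
    by rewrite /chain_des /descents eq_card0 // => -[].
  move=> u v uv.
  have [s s_path s_last] :
      exists2 s, path (covers (le_hat le)) None s & last None s = u.
    case: u {uv} => [a|]; last by exists [::].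
    by have [s [? ?]] := saturated_chain_to_exists lab a; exists s.
  (* A chain to [u] extends by [v]; comparing the two descent counts isolates the increment along
     this cover. *)
  have := q_last (rcons s v); rewrite rcons_path s_path s_last uv last_rcons.
  by move=> /(_ isT) ->; rewrite chain_des_rcons PoszD -q_last // s_last.
Qed.

Theorem theorem3p1 (R : realType) (n : nat) (le : rel 'I_n)
    (le_labeled : naturally_labeled le) (le_connected : connected_poset le)
    (tau : 'S_n) (q : {ffun 'I_n -> int}) :
  (translate q (simplex R tau) `<=` lipschitz_polytope le R)%classic <->
  descent_compatible le tau /\
    (forall a : 'I_n, q a = ((des_at le tau a)%:Z)%R).
Proof.
rewrite translate_simplex_subP; exact: descent_incrementsP.
Qed.
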